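(* Let $\mathbb{K}$ be a field, let $G$ be a connected bipartite graph with at least one edge and vertex set $\{v_1,\dots,v_n\}$, let $S=\mathbb{K}[x_1,\dots,x_n]$, and let $I(G)\subseteq S$ be the edge ideal of $G$. Suppose that ${\rm girth}(G)=g$. Then for every positive integer $k\leq g/2+1$, we have ${\rm sdepth}(I(G)^k)\geq 2$.
   Context: Graphs are finite and simple. The edge ideal of $G$ is $I(G)=(x_ix_j : \{v_i,v_j\}\in E(G))\subseteq S$. ${\rm girth}(G)$ is the length of a shortest cycle of $G$, and ${\rm girth}(G)=\infty$ if $G$ has no cycle (in which case the condition $k\leq g/2+1$ holds for every positive integer $k$). Stanley depth: let $M$ be a finitely generated $\mathbb{Z}^n$-graded $S$-module. For a homogeneous $u\in M$ and $Z\subseteq\{x_1,\dots,x_n\}$, the $\mathbb{K}$-subspace $u\mathbb{K}[Z]$ of $M$ generated by all $uv$ with $v$ a monomial in $\mathbb{K}[Z]$ is called a Stanley space of dimension $|Z|$ if it is a free $\mathbb{K}[Z]$-module. A Stanley decomposition $\mathcal{D}$ of $M$ is a decomposition of $M$ (as a $\mathbb{K}$-vector space) as a finite direct sum of Stanley spaces; ${\rm sdepth}(\mathcal{D})$ is the minimum dimension of a Stanley space in $\mathcal{D}$, and ${\rm sdepth}(M)$ is the maximum of ${\rm sdepth}(\mathcal{D})$ over all Stanley decompositions $\mathcal{D}$ of $M$. By convention ${\rm sdepth}(0)=\infty$. *)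

(* Defs.v *)
From HB Require Import structures.
From mathcomp Require Import all_boot all_order all_algebra.
From mathcomp Require Import boolp.
From mathcomp Require Import mpoly.

Set Implicit Arguments.
Unset Strict Implicit.
Unset Printing Implicit Defensive.

Import Order.TTheory GRing.Theory Num.Theory.
Local Open Scope ring_scope.

Variant enat := Fin of nat | Infty.

Definition le_enat (x y : enat) : bool :=
  match x, y with
  | _, Infty => true
  | Infty, Fin _ => false
  | Fin a, Fin b => (a <= b)%N
  end.

Record sgraph (n : nat) := SGraph {
  edge : rel 'I_n;
  edge_sym : ssrbool.symmetric edge;
  edge_irrefl : irreflexive edge
}.

Section Graphs.
Variables (n : nat) (G : sgraph n).

Definition connected : Prop := forall i j, connect (edge G) i j.

Definition bipartite : Prop :=
  exists A : {set 'I_n}, forall i j, edge G i j -> (i \in A) != (j \in A).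

(* The bound 2 < m matters: [ucycle] also accepts [:: i; j] for an edge ij,
   and the empty sequence. *)
Definition has_cycle_of_length (m : nat) : bool :=
  (2 < m)%N && [exists c : m.-tuple 'I_n, ucycleb (edge G) c].

Definition girth : enat :=
  match pselect (exists m, has_cycle_of_length m) with
  | left h => Fin (ex_minn h)
  | right _ => Infty
  end.

End Graphs.

Section Ideals.
Variables (K : fieldType) (n : nat).
Local Notation S := {mpoly K[n]}.

Definition ideal_gen (B : S -> Prop) (p : S) : Prop :=
  exists r (a b : 'I_r -> S), (forall i, B (b i)) /\ p = \sum_i a i * b i.

Definition ideal_mul (I J : S -> Prop) : S -> Prop :=
  ideal_gen (fun p => exists f g, [/\ I f, J g & p = f * g]).

Fixpoint ideal_pow (I : S -> Prop) (k : nat) : S -> Prop :=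
  if k is k'.+1 then ideal_mul I (ideal_pow I k') else fun=> True.

Definition edge_ideal (G : sgraph n) : S -> Prop :=
  ideal_gen (fun p => exists i j, edge G i j /\ p = 'X_i * 'X_j).

End Ideals.

(* Stanley depth of Z^n-graded submodules M of S = K[x_1, ..., x_n], given as
   predicates on S. *)
Section StanleyDepth.
Variables (K : fieldType) (n : nat).
Local Notation S := {mpoly K[n]}.

(* The Z^n-graded component of S of degree m is the line spanned by 'X_[m]. *)
Definition homogeneous (u : S) : Prop :=
  exists (c : K) (m : 'X_{1..n}), u = c *: 'X_[m].

Definition in_subring (Z : {set 'I_n}) (f : S) : Prop :=
  forall m, m \in msupp f -> forall i, m i != 0%N -> i \in Z.

(* Multiplication by u being K-linear, the K-span of the products of u with the
   monomials of K[Z] is the set of products of u with elements of K[Z]. *)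
Definition stanley_span (u : S) (Z : {set 'I_n}) (p : S) : Prop :=
  exists f, in_subring Z f /\ p = u * f.

(* The cyclic K[Z]-module uK[Z] is free on its generator u; in
   particular u != 0. *)
Definition stanley_free (u : S) (Z : {set 'I_n}) : Prop :=
  forall f, in_subring Z f -> u * f = 0 -> f = 0.

Definition stanley_decomposition (M : S -> Prop) (r : nat)
    (u : 'I_r -> S) (Z : 'I_r -> {set 'I_n}) : Prop :=
  [/\ forall i, [/\ M (u i), homogeneous (u i) & stanley_free (u i) (Z i)],
      forall p, M p <->
        exists q : 'I_r -> S,
          (forall i, stanley_span (u i) (Z i) (q i)) /\ p = \sum_i q i
    & forall q : 'I_r -> S,
        (forall i, stanley_span (u i) (Z i) (q i)) ->
        \sum_i q i = 0 -> forall i, q i = 0].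

(* The default value n is an upper bound of all the #|Z i|, so this is their
   minimum as soon as 0 < r. *)
Definition decomposition_sdepth (r : nat) (Z : 'I_r -> {set 'I_n}) : nat :=
  \big[minn/n]_(i < r) #|Z i|.

(* The convention is sdepth 0 = Infty. Otherwise, the depth of a decomposition
   is at most n, which bounds the range of the maximum; a range without any
   decomposition would give the value 0. *)
Definition sdepth (M : S -> Prop) : enat :=
  if `[< forall p, M p -> p = 0 >] then Infty
  else Fin (\max_(d < n.+1 |
         `[< exists r (u : 'I_r -> S) (Z : 'I_r -> {set 'I_n}),
               stanley_decomposition M u Z /\ decomposition_sdepth Z = d >]) d).

End StanleyDepth.

(* Main.v *)
Require Import Defs.
From mathcomp Require Import all_boot all_order all_algebra.
From mathcomp Require Import boolp.
From mathcomp Require Import mpoly.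
From mathcomp Require Import zify lra.

Set Implicit Arguments.
Unset Strict Implicit.
Unset Printing Implicit Defensive.

Import Order.TTheory GRing.Theory Num.Theory.

(** The ideal I(G)^k is spanned by the monomials that are divisible by a product
    of k edges, here called [matchable].  A Stanley decomposition of depth at
    least 2 is obtained from a partition of these exponent vectors into finitely
    many boxes, each of them unbounded in at least two directions
    ([depth_ge2], [sdepth_ge2]).

    Fix a vector u and a set F of variables, and look at the slice of the
    matchable m >= u that agree with u on F.  For z outside F, either m z = u z
    or m z > u z, so a slice splits into the slice where z is closed (added to
    F) and the slice where u is multiplied by z ([slice_split]).  Splitting goes
    on until two open variables x, y are found such that every nonempty fibre
    of the slice in the directions x and y has a least element.  Such a slice is a
    finite union of boxes: fix the other variables one by one, up to a bound
    beyond which they have no influence ([depth_ge2_principal_fibres]).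

    The choice of the splittings follows a path of G.  Let u be the product of
    the vertices of a path ending at x, with the previous vertex y.  The
    neighbours z of x other than y are closed one after the other; whenever
    instead u is multiplied by z, the path grows.  Three things may happen.
    - The path reaches 2k vertices: then u itself is a product of k edges, and
      the slice is a single box ([slice_matchable]).
    - All neighbours of x except y are closed at exponent 0: then x is in effect
      a leaf hanging at y, and the fibres in x, y are principal by an exchange
      argument between two products of k edges ([matchable_gcd_leaf]).
    - Some neighbour of x is already on the path: a cycle is closed.  Its length
      is at least the girth, hence at least 2k - 2, and at most the number
      2k - 1 of vertices available.  As G is bipartite, it is 2k - 2, and the
      path is the cycle D followed by at most one vertex.

    In the last case D carries k - 1 disjoint edges, one less than needed.
    Multiplying D by a neighbour a of D on one side and by a neighbour b of D on
    the other gives a matchable monomial ([cycle_augment]).  Hence the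
    neighbours of D may be closed, since opening them leads to full boxes.
    Once those on one side are closed, one of any k edges must avoid D
    altogether ([closed_cycle_matchable]), so that the exponents of the vertices
    of D on the opposite side no longer matter, and the fibres are principal
    ([slice_cycle_pendant], [slice_cycle]). *)

(** * Products of k edges dividing a monomial *)

Section Matchings.
Variables (n : nat) (G : sgraph n).
Implicit Types (m : 'X_{1..n}) (M N : seq ('I_n * 'I_n)) (B : {set 'I_n}).
Implicit Types (i j x y z : 'I_n) (k : nat).

Definition bipartition B := forall i j, edge G i j -> (i \in B) != (j \in B).

Definition edge_mnm (e : 'I_n * 'I_n) : 'X_{1..n} := (U_(e.1) + U_(e.2))%MM.

Definition matching_mnm M : 'X_{1..n} := (\sum_(e <- M) edge_mnm e)%MM.

Definition matchable k m :=
  exists M, [/\ size M = k, all (fun e => edge G e.1 e.2) M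
               & (matching_mnm M <= m)%MM].

Lemma bipartitionC B : bipartition B -> bipartition (~: B).
Proof. by move=> bipB i j /bipB; rewrite !inE; do 2!case: (_ \in B). Qed.

Lemma edge_mnmE e i : edge_mnm e i = ((e.1 == i) + (e.2 == i))%N.
Proof. by rewrite mnmDE !mnm1E. Qed.

Lemma matching_mnm_cons e M i :
  matching_mnm (e :: M) i = (edge_mnm e i + matching_mnm M i)%N.
Proof. by rewrite /matching_mnm big_cons mnmDE. Qed.

Lemma matching_mnm_rem e M i : e \in M ->
  matching_mnm M i = (edge_mnm e i + matching_mnm (rem e M) i)%N.
Proof.
by move=> /perm_to_rem pM; rewrite -matching_mnm_cons /matching_mnm (perm_big _ pM).
Qed.

Lemma matching_mnm_gt0 M i :
  (0 < matching_mnm M i)%N -> exists2 e, e \in M & (e.1 == i) || (e.2 == i).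
Proof.
elim: M => [|e M IH]; first by rewrite /matching_mnm big_nil mnmE.
rewrite matching_mnm_cons edge_mnmE.
have [ei _|] := boolP ((e.1 == i) || (e.2 == i)).
  by exists e => //; rewrite mem_head.
rewrite negb_or => /andP[/negPf-> /negPf->] /IH[f fM fi].
by exists f => //; rewrite inE fM orbT.
Qed.

Lemma matching_mnm_bound M i : (matching_mnm M i <= (size M).*2)%N.
Proof.
elim: M => [|e M IH]; first by rewrite /matching_mnm big_nil mnmE.
rewrite matching_mnm_cons edge_mnmE doubleS -add2n leq_add //.
by do 2!case: (_ == _).
Qed.

Lemma matchable_le k m1 m2 : (m1 <= m2)%MM -> matchable k m1 -> matchable k m2.
Proof.
by move=> le12 [M [sM eM leM]]; exists M; split=> //; apply: lepm_trans le12.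
Qed.

Lemma matchableD k1 k2 m1 m2 :
  matchable k1 m1 -> matchable k2 m2 -> matchable (k1 + k2) (m1 + m2)%MM.
Proof.
move=> [M [<- eM leM]] [N [<- eN leN]]; exists (M ++ N).
split; [by rewrite size_cat | by rewrite all_cat eM |].
apply/mnm_lepP => i; rewrite /matching_mnm big_cat !mnmDE.
by apply: leq_add; move: i; apply/mnm_lepP.
Qed.

Lemma matchable_edge x y : edge G x y -> matchable 1 (U_(x) + U_(y))%MM.
Proof.
move=> exy; exists [:: (x, y)]; rewrite /= exy; split=> //.
by rewrite /matching_mnm big_seq1 lepm_refl.
Qed.

Definition oriented B (e : 'I_n * 'I_n) := edge G e.1 e.2 && (e.1 \notin B).

Lemma oriented_edge B M :
  all (oriented B) M -> all (fun e => edge G e.1 e.2) M.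
Proof. by apply: sub_all => e /andP[]. Qed.

Lemma oriented2 B e : bipartition B -> oriented B e -> e.2 \in B.
Proof. by move=> bipB /andP[/bipB + /negPf e1]; rewrite e1; case: (_ \in B). Qed.

(** Listing every edge with its endpoint outside [B] first turns degrees on
    either side into counts over the list. *)
Lemma matchable_oriented B k m : bipartition B -> matchable k m ->
  exists M, [/\ size M = k, all (oriented B) M & (matching_mnm M <= m)%MM].
Proof.
move=> bipB [M [sM eM leM]].
pose sw (e : 'I_n * 'I_n) := if e.1 \in B then (e.2, e.1) else e.
exists (map sw M); split; first by rewrite size_map.
  rewrite all_map; apply: sub_all eM => e /= ee.
  rewrite /oriented /sw; case: ifPn => e1 /=; last by rewrite ee.
  by rewrite edge_sym ee /=; move: (bipB _ _ ee); rewrite e1; case: (_ \in B).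
rewrite /matching_mnm big_map (eq_bigr edge_mnm) // => e _.
by rewrite /sw /edge_mnm; case: ifP => //= _; rewrite addmC.
Qed.

Lemma sum_matching_mnm (C : {set 'I_n}) B M : bipartition B -> C \subset B ->
  all (oriented B) M ->
  (\sum_(b in C) matching_mnm M b = count (fun e => e.2 \in C) M)%N.
Proof.
move=> bipB CB; elim: M => [_|e M IH /= /andP[oe oM]].
  by rewrite big1 // => b _; rewrite /matching_mnm big_nil mnmE.
rewrite (eq_bigr (fun b => (e.2 == b) + matching_mnm M b)%N) => [|b bC].
  rewrite big_split /= IH //; congr (_ + _)%N.
  case: (boolP (e.2 \in C)) => eC.
    rewrite (bigD1 e.2) //= eqxx big1 // => b /andP[_ /negPf].
    by rewrite eq_sym => ->.
  by rewrite big1 // => b bC; case: eqP => // eb; rewrite eb bC in eC.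
rewrite matching_mnm_cons edge_mnmE.
case: eqP => // e1b; case/andP: oe => _; rewrite e1b.
by rewrite (subsetP CB).
Qed.

Lemma sum_matching_mnmC B M : bipartition B -> all (oriented B) M ->
  (\sum_(a in ~: B) matching_mnm M a = size M)%N.
Proof.
move=> bipB; elim: M => [_|e M IH /= /andP[oe oM]].
  by rewrite big1 // => b _; rewrite /matching_mnm big_nil mnmE.
rewrite (eq_bigr (fun b => (e.1 == b) + matching_mnm M b)%N) => [|a aB].
  rewrite big_split /= IH // -[_.+1]add1n; congr (_ + _)%N.
  rewrite (bigD1 e.1) /= ?eqxx ?big1 // => [b /andP[_ /negPf]|].
    by rewrite eq_sym => ->.
  by rewrite inE; case/andP: oe.
rewrite matching_mnm_cons edge_mnmE.
case: (e.2 =P a) => [e2a|_]; last by rewrite addn0.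
by move: aB (oriented2 bipB oe); rewrite e2a inE => /negPf->.
Qed.

(** If x is a leaf hanging at y, then being a product of k edges is stable under
    gcd in the variables x and y.  Take k edges M dividing m x^s and k edges N
    dividing m y^t.  If M uses x more often than m allows, then M uses some
    other vertex a of the side of x less often than N does, and an edge e of N
    at a can replace an edge of M: either one that meets e on the other side,
    or one at the leaf x, whichever makes room for e.  Now e is common to both,
    it divides m, and induction applies to m / e. *)
Lemma matchable_gcd_leaf B x y k m s t : bipartition B -> edge G x y -> x \notin B ->
    (forall z, edge G x z -> z != y -> m z = 0%N) ->
  matchable k (m + U_(x) *+ s)%MM -> matchable k (m + U_(y) *+ t)%MM ->
  matchable k m.
Proof.
move=> bipB exy xB.
have yB : y \in B by move: (bipB _ _ exy) xB; do 2!case: (_ \in B).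
have nxy : x != y by apply: contraTneq yB => <-.
elim: k m => [|k IH] m mx0.
  move=> _ _; exists [::]; rewrite /matching_mnm big_nil; split=> //.
  by apply/mnm_lepP => i; rewrite mnmE.
move=> /(matchable_oriented bipB)[M [sM oM /mnm_lepP leM]].
move=> /(matchable_oriented bipB)[N [sN oN /mnm_lepP leN]].
have {}leM i : (matching_mnm M i <= m i + (x == i) * s)%N.
  by move: (leM i); rewrite mnmDE mulmnE mnm1E.
have {}leN i : (matching_mnm N i <= m i + (y == i) * t)%N.
  by move: (leN i); rewrite mnmDE mulmnE mnm1E.
(* An edge e of N is divided out of m once e :: M' divides m x^s. *)
have reduce e M' : e \in N -> size M' = k -> all (oriented B) M' ->
    (forall i, matching_mnm M' i + edge_mnm e i <= m i + (x == i) * s)%N ->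
    (forall i, edge_mnm e i <= m i)%N -> matchable k.+1 m.
  move=> eN sM' oM' leM' leem.
  have le_em : (edge_mnm e <= m)%MM by apply/mnm_lepP.
  rewrite -(submK le_em) -addn1; apply: matchableD; last first.
    by apply: matchable_edge; case/andP: (allP oN _ eN).
  apply: IH => [z exz nzy||].
  - by rewrite mnmBE mx0.
  - exists M'; split=> //; first exact: oriented_edge oM'.
    apply/mnm_lepP => i; rewrite mnmDE mnmBE mulmnE mnm1E.
    by have := leM' i; have := leem i; clear; lia.
  - exists (rem e N); split; first by rewrite size_rem // sN.
      by apply/oriented_edge/allP => f /mem_rem; apply: (allP oN).
    apply/mnm_lepP => i; rewrite mnmDE mnmBE mulmnE mnm1E.
    have := leN i; rewrite (matching_mnm_rem _ eN).
    by have := leem i; clear; lia.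
have [fits|big] := leqP (matching_mnm M x) (m x).
  exists M; split=> //; first exact: oriented_edge oM.
  apply/mnm_lepP => i; have := leM i.
  by case: (x =P i) => [<-|_] //; rewrite addn0.
(* Both lists have total degree k on the side of x, and M exceeds N at x. *)
have [a [aB ltMN]] : exists a, a \notin B /\
    (matching_mnm M a < matching_mnm N a)%N.
  apply: contrapT => H.
  have : (\sum_(a in ~: B) matching_mnm N a < \sum_(a in ~: B) matching_mnm M a)%N.
    rewrite (bigD1 x) ?inE //= [X in (_ < X)%N](bigD1 x) ?inE //=.
    rewrite -addSn; apply: leq_add.
      have := leN x; rewrite [y == x]eq_sym (negPf nxy); move: big; clear; lia.
    apply: leq_sum => a; rewrite inE => /andP[aB _].
    by rewrite leqNgt; apply/negP => lt; apply: H; exists a.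
  by rewrite !sum_matching_mnmC // sM sN ltnn.
have [e eN ea] : exists2 e, e \in N & e.1 = a.
  have [|e eN /orP[/eqP<-|/eqP e2]] := @matching_mnm_gt0 N a;
    first by move: ltMN; clear; lia.
    by exists e.
  by move: (oriented2 bipB (allP oN _ eN)); rewrite e2 (negPf aB).
have eB := oriented2 bipB (allP oN _ eN).
have ay : (y == a) = false by apply: contraNF aB => /eqP<-.
have e1B i : i \in B -> (e.1 == i) = false.
  by move=> iB; apply: contraTF iB => /eqP<-; rewrite ea.
have e2x : (e.2 == x) = false by apply: contraTF eB => /eqP->.
(* The edge f of M to be replaced by e; if there is no room for e at its
   endpoint e.2, then M has an edge there. *)
have [f fM [fa fe]] : exists2 f, f \in M &
    (matching_mnm M a + edge_mnm e a <= m a + edge_mnm f a)%N /\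
    (matching_mnm M e.2 + edge_mnm e e.2 <= m e.2 + edge_mnm f e.2)%N.
  have fy f : f \in M -> f.1 = x -> f.2 = y.
    move=> fM f1; apply/eqP; apply: contraTT (fM) => f2y; apply/negP => _.
    have ef : edge G x f.2 by rewrite -f1; case/andP: (allP oM _ fM).
    have := leM f.2; rewrite mx0 //.
    rewrite (matching_mnm_rem _ fM) edge_mnmE eqxx.
    rewrite (_ : (x == f.2) = false); first by clear; lia.
    by apply: contraTF ef => /eqP<-; rewrite edge_irrefl.
  have Ma f : (matching_mnm M a + edge_mnm e a <= m a + edge_mnm f a)%N.
    have := leN a; rewrite ay edge_mnmE ea eqxx.
    rewrite (_ : (e.2 == a) = false); first by move: ltMN; clear; lia.
    by apply: contraTF eB => /eqP->.
  have Ee2 : edge_mnm e e.2 = 1%N by rewrite edge_mnmE eqxx e1B.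
  have xe2 : (x == e.2) = false by rewrite eq_sym.
  have [e2y|/negPf e2y] := eqVneq e.2 y.
    have [|f fM /orP[/eqP f1|/eqP f2]] := @matching_mnm_gt0 M x;
      first by move: big; clear; lia.
      exists f => //; split; first exact: Ma.
      rewrite Ee2 edge_mnmE (fy _ fM f1) -e2y eqxx.
      by have := leM e.2; rewrite xe2; clear; lia.
    by move: (oriented2 bipB (allP oM _ fM)); rewrite f2 (negPf xB).
  have [sat|unsat] := leqP (m e.2) (matching_mnm M e.2).
    have : (0 < matching_mnm N e.2)%N.
      by rewrite (matching_mnm_rem _ eN) Ee2.
    move=> N0; have [|f fM ff] := @matching_mnm_gt0 M e.2.
      by have := leN e.2; rewrite eq_sym e2y; move: sat N0; clear; lia.
    exists f => //; split; first exact: Ma.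
    rewrite Ee2 edge_mnmE; move: ff; have := leM e.2; rewrite xe2.
    by do 2!case: (_ == _) => //=; clear; lia.
  have [|f fM /orP[/eqP f1|/eqP f2]] := @matching_mnm_gt0 M x;
      first by move: big; clear; lia.
    exists f => //; split; first exact: Ma.
    by rewrite Ee2; move: unsat; clear; lia.
  by move: (oriented2 bipB (allP oM _ fM)); rewrite f2 (negPf xB).
have swapped i : (matching_mnm (rem f M) i + edge_mnm e i <= m i + (x == i) * s)%N.
  have := leM i; have := fa; have := fe.
  rewrite !(matching_mnm_rem _ fM).
  have [->|ia] := eqVneq i a; first (clear; lia).
  have [->|ie] := eqVneq i e.2; first (clear; lia).
  by rewrite (edge_mnmE e i) ea ![_ == i]eq_sym (negPf ia) (negPf ie); clear; lia.
apply: (reduce e (rem f M)) => // [||i].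
- by rewrite size_rem // sM.
- by apply/allP => g /mem_rem; apply: (allP oM).
- have := swapped i; have := leN i.
  rewrite (matching_mnm_rem _ eN).
  case: (x =P i) => [<-|_]; rewrite 1?[y == x]eq_sym ?(negPf nxy); clear; lia.
Qed.

(** A set of vertices of one side of total degree less than k cannot serve all
    of k edges. *)
Lemma exit_edge B (C : {set 'I_n}) k m : bipartition B -> C \subset B ->
  matchable k m -> (\sum_(b in C) m b < k)%N ->
  exists a b, [/\ edge G a b, a \notin B, b \in B :\: C, (0 < m a)%N & (0 < m b)%N].
Proof.
move=> bipB CB /(matchable_oriented bipB)[M [sM oM /mnm_lepP leM]] small.
have : ~~ all (fun e => e.2 \in C) M.
  apply: contraL small; rewrite all_count => /eqP eqC; rewrite -leqNgt.
  by rewrite -sM -eqC -(sum_matching_mnm bipB) // leq_sum.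
case/allPn => e eM e2; case/andP: (allP oM _ eM) => ee e1B.
exists e.1, e.2; rewrite ee e1B inE e2 (oriented2 bipB (allP oM _ eM)).
have := leM e.1; have := leM e.2.
rewrite !(matching_mnm_rem _ eM) !edge_mnmE.
rewrite !eqxx.
by move=> le2 le1; split=> //; move: le1 le2; clear; lia.
Qed.

End Matchings.

(** * Partitions into boxes unbounded in two directions *)

Section Boxes.
Variable n : nat.
Implicit Types (m u : 'X_{1..n}) (b : 'X_{1..n} * {set 'I_n}).
Implicit Types (P : 'X_{1..n} -> Prop) (x y z : 'I_n).

Definition in_box b m :=
  [forall i, if i \in b.2 then (b.1 i <= m i)%N else m i == b.1 i].

Definition box_partition P (s : seq ('X_{1..n} * {set 'I_n})) :=
  forall m, count (in_box^~ m) s = `[< P m >].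

Definition depth_ge2 P :=
  exists2 s, all (fun b => (1 < #|b.2|)%N) s & box_partition P s.

Lemma depth_ge2_empty P : (forall m, ~ P m) -> depth_ge2 P.
Proof. by move=> P0; exists [::] => // m; rewrite asboolF. Qed.

Lemma depth_ge2_split P P1 P2 :
    (forall m, P m <-> P1 m \/ P2 m) -> (forall m, P1 m -> ~ P2 m) ->
  depth_ge2 P1 -> depth_ge2 P2 -> depth_ge2 P.
Proof.
move=> PE disj [s1 s1Z s1P] [s2 s2Z s2P].
exists (s1 ++ s2); first by rewrite all_cat s1Z.
move=> m; rewrite count_cat s1P s2P (asbool_equiv_eq (PE m)) asbool_or.
have := disj m; case: asboolP => p1; case: asboolP => p2 // /(_ p1).
by case.
Qed.

(** Vectors are grouped by their coordinates other than x and y, truncated at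
    the bound N beyond which these coordinates do not matter.  Each group is
    empty, or a single box: its corner is the least element in the directions
    x and y, and it is unbounded in x, in y and in all truncated
    coordinates. *)
Lemma depth_ge2_principal_fibres P x y N : x != y ->
    (forall m m', (forall z, z != x -> z != y ->
         minn N (m z) = minn N (m' z)) ->
       (m x <= m' x)%N -> (m y <= m' y)%N -> P m -> P m') ->
    (forall m s t, P (m + U_(x) *+ s)%MM -> P (m + U_(y) *+ t)%MM -> P m) ->
  depth_ge2 P.
Proof.
move=> nxy Pup Pgcd.
(* The coordinates x and y get the dummy value 0. *)
pose tr m : {ffun 'I_n -> 'I_N.+1} :=
  [ffun z => if (z == x) || (z == y) then ord0 else inord (minn N (m z))].
have trE m z : z != x -> z != y -> tr m z = minn N (m z) :> nat.
  by move=> /negPf zx /negPf zy; rewrite ffunE zx zy inordK // ltnS geq_minl.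
have tr_eq m m' : (forall z, z != x -> z != y ->
    minn N (m z) = minn N (m' z)) -> tr m = tr m'.
  move=> E; apply/ffunP => z; rewrite !ffunE.
  by case: ifP => // /negbT; rewrite negb_or => /andP[zx zy]; rewrite E.
(* c is the corner of the box of the group w. *)
pose gen w c := [/\ P c, tr c = w,
  forall z, z != x -> z != y -> (c z <= N)%N &
  forall m, P m -> tr m = w -> (c x <= m x)%N /\ (c y <= m y)%N].
have gen_ex m : P m -> exists c, gen (tr m) c.
  move=> Pm.
  pose c i j : 'X_{1..n} := [multinom (if z == x then i else if z == y then j
    else minn N (m z)) | z < n].
  have yx : (y == x) = false by rewrite eq_sym (negPf nxy).
  have cx i j : c i j x = i by rewrite mnmE eqxx.
  have cy i j : c i j y = j by rewrite mnmE yx eqxx.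
  have cz i j z : z != x -> z != y -> c i j z = minn N (m z).
    by move=> /negPf zx /negPf zy; rewrite mnmE zx zy.
  have trc i j : tr (c i j) = tr m.
    by apply: tr_eq => z zx zy; rewrite cz // minnA minnn.
  have Pc m' : P m' -> tr m' = tr m -> P (c (m' x) (m' y)).
    move=> Pm' tm'; apply: Pup Pm'; rewrite ?cx ?cy // => z zx zy.
    by rewrite cz // minnA minnn -!trE // tm'.
  have exi : exists i, `[< exists j, P (c i j) >].
    by exists (m x); apply/asboolP; exists (m y); apply: Pc.
  have exj : exists j, `[< exists i, P (c i j) >].
    by exists (m y); apply/asboolP; exists (m x); apply: Pc.
  exists (c (ex_minn exi) (ex_minn exj)); split; rewrite ?trc //.
  - case: ex_minnP => i /asboolP[j1 P1] mini.
    case: ex_minnP => j /asboolP[i1 P2] minj.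
    have lei : (i <= i1)%N by apply: mini; apply/asboolP; exists j.
    have lej : (j <= j1)%N by apply: minj; apply/asboolP; exists i.
    apply: (Pgcd _ (i1 - i)%N (j1 - j)%N).
      apply: Pup P2 => [z zx zy||]; rewrite ?mnmDE ?mulmnE ?mnm1E ?cx ?cy ?eqxx.
      - by rewrite !cz // eq_sym (negPf zx) addn0.
      - by rewrite mul1n subnKC.
      - by rewrite leq_addr.
    apply: Pup P1 => [z zx zy||]; rewrite ?mnmDE ?mulmnE ?mnm1E ?cx ?cy ?eqxx.
    - by rewrite !cz // eq_sym (negPf zy) addn0.
    - by rewrite leq_addr.
    - by rewrite mul1n subnKC.
  - by move=> z zx zy; rewrite cz // geq_minl.
  - move=> m' Pm' tm'; rewrite cx cy.
    case: ex_minnP => i _ mini; case: ex_minnP => j _ minj; split.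
      by apply: mini; apply/asboolP; exists (m' y); apply: Pc.
    by apply: minj; apply/asboolP; exists (m' x); apply: Pc.
have /choice[g gP] w : exists c, (exists c', gen w c') -> gen w c.
  by have [[c Hc]|nex] := pselect (exists c, gen w c); [exists c | exists 0%MM].
pose Z (w : {ffun 'I_n -> 'I_N.+1}) :=
  [set z | [|| z == x, z == y | w z == N :> nat]].
have boxP w m : (exists c, gen w c) ->
    in_box (g w, Z w) m = (w == tr m) && `[< P m >].
  move=> /gP[Pg trg gN gmin]; apply/idP/andP.
  - move=> /forallP /= mbox.
    have mz z : z != x -> z != y -> minn N (g w z) = minn N (m z).
      move=> zx zy; move: (mbox z); rewrite inE (negPf zx) (negPf zy) /=.
      case: ifP => [/eqP wz|_ /eqP-> //].
      by move: wz; rewrite -{1}trg trE //; move: (gN _ zx zy); lia.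
    split; first by rewrite -{1}trg; apply/eqP/tr_eq.
    apply/asboolP; apply: Pup Pg => //.
      by move: (mbox x); rewrite inE eqxx.
    by move: (mbox y); rewrite inE eqxx orbT.
  - case=> /eqP wm /asboolP Pm; have [lex ley] := gmin _ Pm (esym wm).
    apply/forallP => z /=; rewrite inE.
    have [->|zx] := eqVneq z x; first by [].
    have [->|zy] := eqVneq z y; first by [].
    have := gN _ zx zy; have := trE m z zx zy; have := trE (g w) z zx zy.
    rewrite trg -wm /=; case: (_ =P N :> nat) => wN.
      by rewrite wN; lia.
    by move=> gz mz gzN; apply/eqP; lia.
exists [seq (g w, Z w) | w <- enum {: {ffun 'I_n -> 'I_N.+1}}
                       & `[< exists c, gen w c >]].
  rewrite all_map; apply/allP => w _ /=.
  rewrite -[2]/(true.+1) -nxy -cards2 subset_leq_card //.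
  by apply/subsetP => z; rewrite !inE => /orP[]->; rewrite ?orbT.
move=> m; rewrite count_map count_filter.
rewrite (@eq_count _ _ (fun w => (w == tr m) && `[< P m >])); last first.
  move=> w /=; case: (asboolP (exists c, gen w c)) => [/boxP->|nex].
    by rewrite andbT.
  rewrite andbF; case: eqP => // wm; case: asboolP => // /gen_ex Hm.
  by case: nex; rewrite wm.
case: asboolP => Pm; last first.
  by rewrite (eq_count (a2 := pred0)) ?count_pred0 // => w; rewrite andbF.
rewrite (eq_count (a2 := pred1 (tr m))) => [|w]; last by rewrite andbT.
by rewrite count_uniq_mem ?enum_uniq // mem_enum.
Qed.
End Boxes.

(** * Slices of the set of matchable monomials *)

Section Slices.
Variables (n : nat) (G : sgraph n) (k : nat).
Implicit Types (m u : 'X_{1..n}) (F W : {set 'I_n}) (x y z : 'I_n).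

Definition slice u F m :=
  [/\ (u <= m)%MM, forall i, i \in F -> m i = u i & matchable G k m].

Definition slice_ge2 u F := depth_ge2 (slice u F).

(** The vectors m >= u either have m z = u z or lie above u + U_(z). *)
Lemma slice_split u F z : z \notin F ->
  slice_ge2 u (z |: F) -> slice_ge2 (u + U_(z))%MM F -> slice_ge2 u F.
Proof.
move=> zF; apply: depth_ge2_split => m; last first.
  move=> [_ mF _] [/mnm_lepP/(_ z) + _ _].
  by rewrite mnmDE mnm1E eqxx mF ?setU11 // addn1 ltnn.
have uzF i : i \in F -> (u + U_(z))%MM i = u i.
  move=> iF; rewrite mnmDE mnm1E; case: eqP => [zi|_]; last by rewrite addn0.
  by rewrite zi iF in zF.
split=> [[/mnm_lepP um mF km]|[][/mnm_lepP um mF km]].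
- have [mz|mz] := eqVneq (m z) (u z).
    left; split=> // [|i]; first exact/mnm_lepP.
    by rewrite !inE => /orP[/eqP->//|/mF].
  right; split=> // [|i iF]; last by rewrite uzF // mF.
  apply/mnm_lepP => i; rewrite mnmDE mnm1E; have := um i.
  by case: (z =P i) mz => [<-|_] *; lia.
- by split=> // [|i iF]; [apply/mnm_lepP | rewrite mF // inE iF orbT].
- split=> // [|i iF]; last by rewrite mF // uzF.
  by apply/mnm_lepP => i; apply: leq_trans (um i); rewrite mnmDE leq_addr.
Qed.

(** Closing the variables of W one at a time splits off, for each w in W, one
    slice in which w is multiplied into u. *)
Lemma slice_close W u F :
    (forall F' w, F \subset F' -> F' \subset F :|: W -> w \in W ->
       w \notin F' -> slice_ge2 (u + U_(w))%MM F') ->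
  slice_ge2 u (F :|: W) -> slice_ge2 u F.
Proof.
move=> opened closed.
suff H d F' : (#|W :\: F'| <= d)%N -> F \subset F' -> F' \subset F :|: W ->
    slice_ge2 u F' by apply: (H _ F (leqnn _)); rewrite ?subsetUl.
elim: d F' => [|d IH] F' le_d FF' F'W.
  suff -> : F' = F :|: W by [].
  apply/eqP; rewrite eqEsubset F'W subUset FF' /=.
  by rewrite -setD_eq0 -cards_eq0 -leqn0.
have [|[w /setDP[wW wF']]] := set_0Vmem (W :\: F').
  by move=> W0; apply: IH => //; rewrite W0 cards0.
apply: (slice_split wF'); last exact: opened.
apply: IH.
- rewrite -ltnS (leq_trans _ le_d) //; apply: proper_card.
  apply/properP; split; first by apply: setDS; rewrite subsetUr.
  by exists w; rewrite !inE ?wW ?wF' // eqxx.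
- by rewrite (subset_trans FF') // subsetUr.
- by rewrite subUset F'W sub1set inE wW orbT.
Qed.

Lemma slice_principal u F x y : x != y -> x \notin F -> y \notin F ->
    (forall m s t, (u <= m)%MM -> (forall i, i \in F -> m i = u i) ->
       matchable G k (m + U_(x) *+ s)%MM -> matchable G k (m + U_(y) *+ t)%MM ->
       matchable G k m) ->
  slice_ge2 u F.
Proof.
move=> nxy xF yF gcdP.
(* N exceeds the exponents of u and any exponent that k edges can use. *)
pose N := (k.*2 + \max_i u i).+1.
have uN i : (u i < N)%N by rewrite ltnS (leq_trans (leq_bigmax i)) // leq_addl.
apply: (@depth_ge2_principal_fibres _ _ x y N nxy).
- move=> m m' eqm lex ley [/mnm_lepP um mF [M [sM eM /mnm_lepP leM]]].
  have lem i b : (b <= m i)%N -> (b < N)%N -> (b <= m' i)%N.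
    move=> bm bN; have [ix|ix] := eqVneq i x.
      by move: bm lex; rewrite ix; apply: leq_trans.
    have [iy|iy] := eqVneq i y; first by move: bm ley; rewrite iy; apply: leq_trans.
    by move: (eqm i ix iy) bm bN; clear; lia.
  split; first by apply/mnm_lepP => i; apply: lem.
  + move=> i iF; have ix : i != x by apply: contraTneq iF => ->.
    have iy : i != y by apply: contraTneq iF => ->.
    by move: (eqm i ix iy) (uN i); rewrite -(mF i iF); clear; lia.
  + exists M; split=> //; apply/mnm_lepP => i; apply: lem => //.
    by rewrite ltnS (leq_trans (matching_mnm_bound M i)) // sM leq_addr.
- move=> m s t [/mnm_lepP ux xF1 kx] [/mnm_lepP uy _ ky].
  have um : (u <= m)%MM.
    apply/mnm_lepP => i; have := ux i; have := uy i.
    rewrite !mnmDE !mulmnE !mnm1E.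
    by case: (x =P i) => [<-|_ _]; rewrite ?addn0 // eq_sym (negPf nxy) addn0.
  have mF i : i \in F -> m i = u i.
    move=> iF; rewrite -xF1 // mnmDE mulmnE mnm1E.
    by case: (x =P i) => [xi|_]; rewrite ?addn0 //; rewrite xi iF in xF.
  by split=> //; apply: gcdP um mF kx ky.
Qed.

End Slices.

(** * Products of the vertices of a path or of an even cycle *)

Section Paths.
Variables (n : nat) (G : sgraph n).
Implicit Types (m u : 'X_{1..n}) (B F W : {set 'I_n}) (x y z : 'I_n).
Implicit Types (p q D : seq 'I_n) (k t : nat).

Definition path_mnm p : 'X_{1..n} := (\sum_(v <- p) U_(v))%MM.

Lemma path_mnmE p i : path_mnm p i = count_mem i p.
Proof.
elim: p => [|v p IH]; first by rewrite /path_mnm big_nil mnmE.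
by rewrite /path_mnm big_cons mnmDE mnm1E -/(path_mnm p) IH.
Qed.

Lemma sum_count_mem (C : {set 'I_n}) p :
  (\sum_(i in C) count_mem i p = count (mem C) p)%N.
Proof.
elim: p => [|v p IH] /=; first by rewrite big1.
rewrite big_split /= IH; congr (_ + _)%N.
have [vC|vC] := boolP (v \in C).
  by rewrite (bigD1 v) //= eqxx big1 // => i /andP[_ /negPf]; rewrite eq_sym => ->.
by rewrite big1 // => i iC; case: eqP => // vi; rewrite vi iC in vC.
Qed.

Lemma path_mnm_cons v p : path_mnm (v :: p) = (path_mnm p + U_(v))%MM.
Proof. by apply/mnmP => i; rewrite mnmDE !path_mnmE mnm1E addnC. Qed.

Lemma path_mnm_eq0 p i : i \notin p -> path_mnm p i = 0%N.
Proof. by rewrite path_mnmE => /count_memPn. Qed.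

Lemma even_path_matchable p t :
  sorted (edge G) p -> size p = t.*2 -> matchable G t (path_mnm p).
Proof.
elim: t p => [|t IH] [|a [|b p]] //=.
  exists [::]; split=> //; apply/mnm_lepP => i.
  by rewrite /matching_mnm big_nil mnmE.
rewrite doubleS => /andP[ab bp] [sp].
have -> : path_mnm [:: a, b & p] = (path_mnm p + (U_(a) + U_(b)))%MM.
  by apply/mnmP => i; rewrite !path_mnm_cons !mnmDE; clear; lia.
rewrite -addn1; apply: matchableD (matchable_edge ab).
by apply: IH => //; apply: path_sorted bp.
Qed.

Lemma even_path_side B p t : bipartition G B ->
  sorted (edge G) p -> size p = t.*2 -> count (mem B) p = t.
Proof.
move=> bipB; elim: t p => [|t IH] [|a [|b p]] //=.
rewrite doubleS => /andP[ab bp] [sp]; rewrite (IH p) ?(path_sorted bp) //.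
by move: (bipB _ _ ab); do 2!case: (_ \in B).
Qed.

Lemma path_side B x p : bipartition G B -> path (edge G) x p ->
  (last x p \in B) = (x \in B) (+) odd (size p).
Proof.
move=> bipB; elim: p x => [|y p IH] x /=; first by rewrite addbF.
by case/andP => xy /IH->; move: (bipB _ _ xy); do 2!case: (_ \in B); case: odd.
Qed.

Lemma slice_matchable k u F x y : x != y -> x \notin F -> y \notin F ->
  matchable G k u -> slice_ge2 G k u F.
Proof.
move=> nxy xF yF ku; apply: (slice_principal nxy) => // m s t um _ _ _.
exact: matchable_le um ku.
Qed.

(** In this section the cycle D carries t disjoint edges, and t + 1 edges are
    wanted. *)
Section EvenCycle.
Variables (t : nat) (D : seq 'I_n).
Hypotheses (cycD : cycle (edge G) D) (sizeD : size D = t.*2).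

Let sortedD : sorted (edge G) D.
Proof. by case: (D) cycD => //= x p; rewrite rcons_path => /andP[]. Qed.

Lemma cycle_neighbour x : x \in D -> exists2 y, y \in D & edge G y x.
Proof. by move=> xD; exists (prev D x); rewrite ?mem_prev // prev_cycle. Qed.

(** Removing two vertices a1, b1 of opposite sides cuts an even cycle into two
    paths with an even number of vertices each.  Prolonging one of them by the
    edge a b1 and the other by b a1 keeps the numbers even. *)
Lemma cycle_augment B a a1 b b1 : bipartition G B ->
    edge G a b1 -> b1 \in D -> b1 \in B -> edge G b a1 -> a1 \in D ->
    a1 \notin B ->
  matchable G t.+1 (path_mnm D + U_(a) + U_(b))%MM.
Proof.
move=> bipB ab1 b1D b1B ba1 a1D a1B.
have [i s rotD] := rot_to b1D.
have pD : perm_eq (b1 :: s) D by rewrite -rotD perm_rot.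
have a1s : a1 \in s.
  move: a1D; rewrite -(perm_mem pD) inE => /orP[/eqP a1b1|//].
  by rewrite a1b1 b1B in a1B.
have : cycle (edge G) (b1 :: s) by rewrite -rotD rot_cycle.
have sE := perm_size pD; rewrite sizeD /= in sE.
case/splitPr: a1s pD sE => s1 s2 pD sE.
rewrite /= rcons_path cat_path /= => /andP[/and3P[ps1 ls1 ps2] _].
have l1B : last b1 s1 \in B.
  by move: (bipB _ _ ls1) a1B; do 2!case: (_ \in B).
have ev1 : odd (size s1) = false.
  by move: (path_side bipB ps1); rewrite l1B b1B; case: odd.
have [c1 s1E] : exists c, size s1 = c.*2.
  by exists (size s1)./2; rewrite -{1}(odd_double_half (size s1)) ev1.
have [c2 s2E tE] : exists2 c, size s2 = c.*2 & t = (c1 + c).+1.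
  move: sE; rewrite size_cat /= s1E => sE.
  by exists (t.-1 - c1); move: sE; rewrite -!addnn; clear; lia.
apply: (@matchable_le _ _ _ (path_mnm (a :: b1 :: s1) + path_mnm (b :: a1 :: s2))%MM).
  apply/mnm_lepP => j; rewrite !path_mnm_cons !mnmDE !mnm1E !path_mnmE.
  by rewrite -(permP pD) /= count_cat /=; clear; lia.
rewrite tE -addSn -addnS; apply: matchableD; apply: even_path_matchable => /=.
- by rewrite ab1.
- by rewrite s1E doubleS.
- by rewrite ba1.
- by rewrite s2E doubleS.
Qed.

(** The vertices of D on the side B have total degree t, so one of t + 1 edges
    avoids them; it also avoids the other side of D, whose neighbours are only
    available inside D.  This edge together with t edges of D divides any m
    that is a multiple of D and involves its two endpoints. *)
Lemma closed_cycle_matchable B m m' : bipartition G B ->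
    matchable G t.+1 m' ->
    (forall b, b \in D -> b \in B -> m' b = path_mnm D b) ->
    (forall a b, a \in D -> a \notin B -> edge G a b -> b \notin D ->
       m' b = 0%N) ->
    (path_mnm D <= m)%MM -> (forall i, i \notin D -> 0 < m' i -> 0 < m i)%N ->
  matchable G t.+1 m.
Proof.
move=> bipB km' m'D m'N /mnm_lepP Dm m'm.
pose C := [set b in B | b \in D].
have [||a [b []]] := @exit_edge _ _ B C _ _ bipB _ km'.
- by apply/subsetP => b; rewrite inE => /andP[].
- rewrite ltnS (eq_bigr (path_mnm D)) => [|b]; last first.
    by rewrite inE => /andP[bB bD]; apply: m'D.
  rewrite -(even_path_side bipB sortedD sizeD).
  rewrite (eq_bigr (fun b => count_mem b D)) => [|b _]; last exact: path_mnmE.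
  by rewrite sum_count_mem; apply: sub_count => b /=; rewrite inE => /andP[].
move=> ab aB /setDP[bB]; rewrite inE bB /= => bD m'a m'b.
have aD : a \notin D by apply: contraTN m'b => aD; rewrite (m'N _ _ aD aB ab).
apply: (@matchable_le _ _ _ (path_mnm D + (U_(a) + U_(b)))%MM); last first.
  rewrite -addn1; apply: matchableD (matchable_edge ab).
  exact: even_path_matchable.
apply/mnm_lepP => i; rewrite !mnmDE !mnm1E.
have ma := m'm _ aD m'a; have mb := m'm _ bD m'b.
have nba : (b == a) = false by apply: contraNF aB => /eqP<-.
have [<-|_] := eqVneq a i; first by rewrite path_mnm_eq0 // nba.
have [<-|_] := eqVneq b i; first by rewrite path_mnm_eq0.
by rewrite !addn0.
Qed.

(** The neighbours of D on the side B are closed, except y: opening any of them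
    gives t + 1 edges together with a.  Then the fibres in the directions a, y
    are principal: above the exponent of y in D every vector is matchable, and
    at this exponent the exponent of a does not matter. *)
Lemma slice_cycle_pendant B F a b1 y : bipartition G B ->
    a \notin B -> edge G a b1 -> b1 \in D -> b1 \in B ->
    a \notin F -> y \notin F -> y \in D -> y \in B ->
  slice_ge2 G t.+1 (path_mnm D + U_(a))%MM F.
Proof.
move=> bipB aB ab1 b1D b1B aF yF yD yB.
have nay : a != y by apply: contraNneq aB => ->.
have ua b : b \in B -> (path_mnm D + U_(a))%MM b = path_mnm D b.
  move=> bB; rewrite mnmDE mnm1E; case: eqP => [ab|_]; last by rewrite addn0.
  by rewrite ab bB in aB.
pose W := [set b | [&& b \in B, b != y &
                     [exists a1, [&& a1 \in D, a1 \notin B & edge G a1 b]]]].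
have aW : a \notin W by rewrite inE (negPf aB).
have yW : y \notin W by rewrite inE eqxx andbF.
have aug b a1 : a1 \in D -> a1 \notin B -> edge G a1 b ->
    matchable G t.+1 (path_mnm D + U_(a) + U_(b))%MM.
  by move=> a1D a1B e; apply: cycle_augment ab1 _ _ _ a1D a1B; rewrite // edge_sym.
have [a1 a1D a1y] := cycle_neighbour yD.
have a1B : a1 \notin B by move: (bipB _ _ a1y); rewrite yB; case: (_ \in B).
apply: (slice_close (W := W)) => [F' w _ F'W|].
  rewrite inE => /and3P[wB _ /existsP[a2 /and3P[a2D a2B a2w]]] _.
  apply: slice_matchable nay _ _ (aug _ _ a2D a2B a2w).
    by apply: contra (subsetP F'W a) _; rewrite in_setU negb_or aF.
  by apply: contra (subsetP F'W y) _; rewrite in_setU negb_or yF.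
apply: (slice_principal nay); rewrite ?in_setU ?negb_or ?aF ?yF //.
move=> m s c um mF ks _.
have [my|my] := leqP (m y) (path_mnm D y); last first.
  apply: matchable_le (aug _ _ a1D a1B a1y); apply/mnm_lepP => i.
  move: (mnm_lepP um i) my; rewrite !mnmDE !mnm1E.
  by case: (y =P i) => [<-|_]; rewrite 1?(negPf nay); clear; lia.
have my_eq : m y = path_mnm D y.
  by apply/eqP; rewrite eqn_leq my -(ua _ yB); apply/(mnm_lepP um).
have m'B b : b \in B -> (m + U_(a) *+ s)%MM b = m b.
  move=> bB; rewrite mnmDE mulmnE mnm1E; case: eqP => [ab|_]; last by rewrite addn0.
  by rewrite ab bB in aB.
have mW b a2 : a2 \in D -> a2 \notin B -> edge G a2 b -> m b = path_mnm D b.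
  move=> a2D a2B a2b.
  have bB : b \in B by move: (bipB _ _ a2b) a2B; do 2!case: (_ \in B).
  have [->//|ny] := eqVneq b y.
  rewrite mF ?ua // !inE bB ny /=; apply/orP; right.
  by apply/existsP; exists a2; rewrite a2D a2B.
apply: (closed_cycle_matchable bipB ks).
- move=> b bD bB; rewrite m'B //; have [a2 a2D a2b] := cycle_neighbour bD.
  by apply: (mW _ _ a2D) (a2b); move: (bipB _ _ a2b); rewrite bB; case: (_ \in B).
- move=> a2 b a2D a2B a2b bD.
  have bB : b \in B by move: (bipB _ _ a2b) a2B; do 2!case: (_ \in B).
  by rewrite m'B // (mW _ _ a2D a2B a2b) path_mnm_eq0.
- by apply: lepm_trans um; apply: lem_addr.
- move=> i iD; rewrite mnmDE mulmnE mnm1E; case: eqP => [<- _|_]; last by rewrite addn0.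
  by apply: leq_trans (mnm_lepP um a); rewrite mnmDE mnm1E eqxx addn1.
Qed.

(** The neighbours a of D outside B are closed; opening one of them is the case
    of [slice_cycle_pendant].  Afterwards the exponents of the vertices of D in
    B do not matter. *)
Lemma slice_cycle B F b b' : bipartition G B -> {in D, forall i, i \notin F} ->
    b != b' -> b \in D -> b \in B -> b' \in D -> b' \in B ->
  slice_ge2 G t.+1 (path_mnm D) F.
Proof.
move=> bipB DF nbb bD bB b'D b'B.
pose W := [set a | (a \notin B) &&
                   [exists b1, [&& b1 \in D, b1 \in B & edge G a b1]]].
have BW i : i \in B -> i \notin W by move=> iB; rewrite inE iB.
have BFW i : i \in D -> i \in B -> i \notin F :|: W.
  by move=> iD iB; rewrite in_setU negb_or DF //= BW.
apply: (slice_close (W := W)) => [F' a _ /subsetP F'W|].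
  rewrite inE => /andP[aB /existsP[b1 /and3P[b1D b1B ab1]]] aF'.
  apply: (slice_cycle_pendant bipB aB ab1) (b1D) (b1B) aF' _ (bD) (bB).
  by apply: contra (F'W b) (BFW b bD bB).
apply: (slice_principal nbb (BFW b bD bB) (BFW b' b'D b'B)) => m s c um mF ks _.
have mW a b1 : b1 \in D -> b1 \in B -> edge G a b1 -> m a = path_mnm D a.
  move=> b1D b1B ab1; apply: mF; rewrite !inE; apply/orP; right.
  apply/andP; split; last by apply/existsP; exists b1; rewrite b1D b1B.
  by move: (bipB _ _ ab1); rewrite b1B; case: (_ \in B).
have m'a a : a \notin B -> (m + U_(b) *+ s)%MM a = m a.
  move=> aB; rewrite mnmDE mulmnE mnm1E; case: eqP => [ba|_]; last by rewrite addn0.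
  by rewrite -ba bB in aB.
apply: (closed_cycle_matchable (bipartitionC bipB) ks) => //.
- move=> a aD; rewrite inE => aB; rewrite m'a //.
  have [b1 b1D b1a] := cycle_neighbour aD.
  apply: (mW _ b1 b1D); last by rewrite edge_sym.
  by move: (bipB _ _ b1a) aB; do 2!case: (_ \in B).
- move=> b1 a b1D; rewrite inE negbK => b1B b1a aD.
  have aB : a \notin B by move: (bipB _ _ b1a); rewrite b1B; case: (_ \in B).
  by rewrite m'a // (mW _ b1) ?path_mnm_eq0 // edge_sym.
- move=> i iD; rewrite mnmDE mulmnE mnm1E; case: eqP => [bi|_]; last by rewrite addn0.
  by rewrite -bi bD in iD.
Qed.

End EvenCycle.
End Paths.

(** * Growing a path *)

Section Growth.
Variables (n : nat) (G : sgraph n) (B : {set 'I_n}) (k : nat).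
Hypotheses (bipB : bipartition G B) (k_gt0 : (0 < k)%N).
Hypothesis long_cycles : forall c, has_cycle_of_length G c -> (k.*2 <= c + 2)%N.
Implicit Types (F W : {set 'I_n}) (x y z : 'I_n) (q : seq 'I_n).

(** The last vertex x of the path is adjacent to an earlier vertex z.  The cycle
    has at least 2k - 2 and, like every cycle of G, an even number of vertices;
    so at most one vertex v of the path precedes z.  If there is one, it is
    pendant to the cycle at z. *)
Lemma slice_path_closing x q1 z q2 F :
    path (edge G) x (rcons q1 z ++ q2) -> uniq (x :: rcons q1 z ++ q2) ->
    {in x :: rcons q1 z ++ q2, forall i, i \notin F} ->
    edge G x z -> q1 != [::] -> (size (rcons q1 z ++ q2)).+1 < k.*2 ->
  slice_ge2 G k (path_mnm (x :: rcons q1 z ++ q2)) F.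
Proof.
rewrite cat_path last_rcons => /andP[pD pq2] + openF xz q1n0 small.
rewrite -cat_cons cat_uniq => /and3P[uD _ _].
set D := x :: rcons q1 z in uD.
have cycD : cycle (edge G) D by rewrite /= rcons_path pD last_rcons edge_sym.
have [t sizeD] : exists t, size D = t.*2.
  exists (size D)./2; rewrite -[LHS]odd_double_half.
  move: (path_side bipB pD) (bipB xz); rewrite last_rcons /D /=.
  by do 2!case: (_ \in B); case: odd.
have cycle_len : (k.*2 <= size D + 2)%N.
  apply: long_cycles; apply/andP; split.
    by move: q1n0; rewrite /D /= size_rcons; case: (q1).
  by apply/existsP; exists (in_tuple D); rewrite /ucycleb cycD uD.
have [sq2 kE] : (size q2 <= 1)%N /\ k = t.+1.
  have sizeD1 : (size (rcons q1 z)).+1 = t.*2 := sizeD.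
  move: small cycle_len; rewrite size_cat -addSn sizeD1 sizeD -!addnn.
  by clear; lia.
have xD : x \in D by rewrite mem_head.
have zD : z \in D by rewrite inE mem_rcons mem_head orbT.
have openD : {in D, forall i, i \notin F}.
  by move=> i iD; apply: openF; rewrite -cat_cons mem_cat iD.
rewrite kE -/D.
case: q2 sq2 pq2 openF small => [|v [|//]] _ /= pq2 openF small.
  rewrite cats0.
  have [C [bipC xC]] : exists C, bipartition G C /\ x \in C.
    have [xB|xB] := boolP (x \in B); first by exists B.
    by exists (~: B); rewrite inE xB; split=> //; apply: bipartitionC.
  case: q1 q1n0 @D pD uD cycD sizeD {cycle_len openF small} xD zD openD
    => // y q1 _ D.
  move=> pD uD cycD sizeD xD zD openD.
  have [c [q' qE]] : exists c q', rcons q1 z = c :: q'.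
    by case: (q1) => [|c q']; [exists z, [::] | exists c, (rcons q' z)].
  apply: (slice_cycle cycD sizeD bipC openD (b := x) (b' := c)) => //.
  - move: uD; rewrite /D /= qE; apply: contraTneq => ->.
    by rewrite !inE eqxx !orbT.
  - by rewrite /D /= qE !inE eqxx !orbT.
  - move: pD; rewrite /= qE /= => /and3P[/bipC + /bipC].
    by rewrite xC; do 2!case: (_ \in C).
have [C [bipC zC]] : exists C, bipartition G C /\ z \in C.
  have [zB|zB] := boolP (z \in B); first by exists B.
  by exists (~: B); rewrite inE zB; split=> //; apply: bipartitionC.
rewrite andbT in pq2.
have -> : path_mnm (D ++ [:: v]) = (path_mnm D + U_(v))%MM.
  by apply/mnmP => i; rewrite mnmDE mnm1E !path_mnmE count_cat /= addn0.
have vz : edge G v z by rewrite edge_sym.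
apply: (slice_cycle_pendant cycD sizeD bipC _ vz zD zC _ _ zD zC).
- by move: (bipC _ _ vz); rewrite zC; case: (_ \in C).
- by apply: openF; rewrite inE mem_cat mem_head !orbT.
- exact: openD.
Qed.

(** The path is listed from its growing end x.  The vertex y is the neighbour of
    x which stays open until the end: the preceding vertex of the path, or any
    neighbour of x if the path is x alone. *)
Lemma slice_path x y q F :
    path (edge G) x q -> uniq (x :: q) -> {in x :: q, forall i, i \notin F} ->
    edge G x y -> y \notin F -> ohead q \in [:: None; Some y] ->
    (size q < k.*2)%N ->
  slice_ge2 G k (path_mnm (x :: q)) F.
Proof.
have [d] := ubnP (k.*2 - size q)%N.
elim: d x y q F => // d IH x y q F le_d pq uq openF xy yF hq small.
have nxy : x != y by apply: contraTneq xy => ->; rewrite edge_irrefl.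
have xF : x \notin F by apply: openF; rewrite mem_head.
have [full|notfull] := eqVneq (size q).+1 k.*2.
  apply: (slice_matchable nxy xF yF).
  by apply: even_path_matchable.
have [/existsP[z /and3P[zq nzy xz]]|] :=
    boolP [exists z, [&& z \in q, z != y & edge G x z]].
  case/splitPr: zq pq uq openF hq small notfull {le_d} => q1 q2.
  rewrite -cat_rcons => pq uq openF hq small notfull.
  apply: slice_path_closing => //; last by rewrite ltn_neqAle notfull.
  by apply: contraTneq hq => ->; rewrite !inE /= (inj_eq Some_inj).
rewrite negb_exists => /forallP noback.
pose W := [set z | edge G x z & z != y].
have openW i : i \in x :: q -> i \notin F :|: W.
  move=> iq; rewrite in_setU negb_or openF //= inE.
  move: iq (noback i); rewrite in_cons => /orP[/eqP->|->] /=.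
    by rewrite edge_irrefl.
  by rewrite [X in ~~ X]andbC.
have yW : y \notin F :|: W by rewrite in_setU negb_or yF inE eqxx andbF.
apply: (slice_close (W := W)) => [F' w _ /subsetP F'W wW wF'|].
  have openF' i : i \in x :: q -> i \notin F'.
    by move=> iq; apply: contra (F'W i) (openW i iq).
  have wq : w \notin x :: q.
    by apply: contraL wW => /openW; rewrite in_setU negb_or => /andP[].
  move: wW; rewrite inE => /andP[xw nwy].
  rewrite -path_mnm_cons; apply: (IH w x (x :: q)) => //=.
  - by move: small notfull le_d; clear; lia.
  - by rewrite edge_sym xw.
  - by apply/andP; split.
  - by move=> i; rewrite in_cons => /orP[/eqP->//|]; apply: openF'.
  - by rewrite edge_sym.
  - by apply: openF'; rewrite mem_head.
  - by rewrite !inE eqxx orbT.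
  - by rewrite ltn_neqAle notfull.
apply: (slice_principal nxy (openW x _) yW); first by rewrite mem_head.
move=> m s c um mF ks kc.
pose C := if x \in B then ~: B else B.
have bipC : bipartition G C by rewrite /C; case: ifP => // _; apply: bipartitionC.
apply: (matchable_gcd_leaf bipC xy _ _ ks kc).
  by rewrite /C; case: ifPn => //; rewrite inE negbK.
move=> z xz nzy; have zW : z \in W by rewrite inE xz.
rewrite mF ?in_setU ?zW ?orbT // path_mnm_eq0 //.
by apply: contraL zW => /openW; rewrite in_setU negb_or => /andP[].
Qed.

(** The vertices outside B that have a neighbour are closed; opening one of them
    starts a path.  When all are closed at exponent 0, no edge is left. *)
Lemma matchable_depth_ge2 : depth_ge2 (matchable G k).
Proof.
pose W := [set w | (w \notin B) && [exists y, edge G w y]].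
suff H : slice_ge2 G k 0%MM set0.
  have [s sZ sP] := H; exists s => // m; rewrite sP.
  congr (nat_of_bool _); apply: asbool_equiv_eq.
  split=> [[]//|km]; split=> // [|i]; last by rewrite inE.
  by apply/mnm_lepP => i; rewrite mnmE.
apply: (slice_close (W := W)) => [F' w _ /subsetP F'W|].
  rewrite inE => /andP[wB /existsP[y wy]] wF'.
  have -> : (0 + U_(w))%MM = path_mnm [:: w].
    by rewrite path_mnm_cons /path_mnm big_nil.
  apply: (@slice_path w y) => //.
  - by move=> i; rewrite inE => /eqP->.
  - apply: contra (F'W y) _; rewrite in_setU inE inE negb_and negbK.
    by move: (bipB wy) wB; do 2!case: (_ \in B).
  - by rewrite double_gt0.
apply: depth_ge2_empty => m [_ mF km].
have [||a [b [ab aB _ ma _]]] := @exit_edge _ G B set0 k m bipB _ km.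
- exact: sub0set.
- by rewrite big_set0.
move: ma; rewrite mF ?mnmE // !inE aB /=.
by apply/existsP; exists b.
Qed.

End Growth.

(** * From exponent vectors to ideals and Stanley decompositions *)

Local Open Scope ring_scope.

Section Algebra.
Variables (K : fieldType) (n : nat).
Local Notation S := {mpoly K[n]}.
Implicit Types (p q f : S) (m u : 'X_{1..n}) (Z : {set 'I_n}).

Definition supported (Q : 'X_{1..n} -> Prop) p := forall m, m \in msupp p -> Q m.

Lemma supportedM Q1 Q2 (Q : 'X_{1..n} -> Prop) p q :
    supported Q1 p -> supported Q2 q ->
    (forall m1 m2, Q1 m1 -> Q2 m2 -> Q (m1 + m2)%MM) ->
  supported Q (p * q).
Proof.
move=> Qp Qq Qm m /msuppM_le/allpairsP[[m1 m2] /= [m1p m2q ->]].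
by apply: Qm; [apply: Qp | apply: Qq].
Qed.

Lemma supported_ideal_gen (Q : 'X_{1..n} -> Prop) (A : S -> Prop) p :
    (forall m1 m2, (m1 <= m2)%MM -> Q m1 -> Q m2) ->
    (forall q, A q -> supported Q q) ->
  ideal_gen A p -> supported Q p.
Proof.
move=> Qup AQ [r [a [b [Ab ->]]]] m /msupp_sum_le/flatten_mapP[i _].
apply: (@supportedM (fun=> True) Q) => // [|m1 m2 _].
  exact/AQ/Ab.
by apply: Qup; apply: lem_addl.
Qed.

Lemma edge_ideal_powP (G : sgraph n) k p :
  ideal_pow (@edge_ideal K n G) k p <-> supported (matchable G k) p.
Proof.
elim: k p => [|k IH] p /=.
  split=> // _ m _; exists [::]; split=> //.
  by rewrite /matching_mnm big_nil; apply/mnm_lepP => i; rewrite mnmE.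
split.
  apply: supported_ideal_gen => [m1 m2|q [f [g [If /IH Ig ->]]]].
    exact: matchable_le.
  apply: (@supportedM (matchable G 1) (matchable G k)) => // [|m1 m2]; last first.
    by rewrite -add1n; apply: matchableD.
  apply: supported_ideal_gen If => [m1 m2|_ [i [j [eij ->]]]].
    exact: matchable_le.
  by move=> m; rewrite -mpolyXD msuppX inE => /eqP->; apply: matchable_edge.
move=> supp_p.
(* A monomial of p is an edge times a multiple of k further edges. *)
have split_mnm m : m \in msupp p -> exists fg : S * S,
    [/\ @edge_ideal K n G fg.1, ideal_pow (@edge_ideal K n G) k fg.2
      & 'X_[m] = fg.1 * fg.2].
  move=> /supp_p[[|e M] [//= [sM] /andP[ee eM] leM]].
  have le_em : (edge_mnm e <= m)%MM.
    apply: lepm_trans leM; apply/mnm_lepP => i.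
    by rewrite matching_mnm_cons leq_addr.
  exists ('X_(e.1) * 'X_(e.2), 'X_[m - edge_mnm e]) => /=; split.
  - exists 1%N, (fun=> 1), (fun=> 'X_(e.1) * 'X_(e.2)); split=> [_|].
      by exists e.1, e.2.
    by rewrite big_ord1 mul1r.
  - apply/IH => m'; rewrite msuppX inE => /eqP->; exists M; split=> //.
    apply/mnm_lepP => i; move: (mnm_lepP leM i).
    by rewrite matching_mnm_cons mnmBE; clear; lia.
  - by rewrite -!mpolyXD addmC submK.
have /choice[fg fgP] (i : 'I_(size (msupp p))) : exists fg : S * S,
    [/\ @edge_ideal K n G fg.1, ideal_pow (@edge_ideal K n G) k fg.2
      & 'X_[nth 0%MM (msupp p) i] = fg.1 * fg.2].
  exact/split_mnm/mem_nth.
exists (size (msupp p)), (fun i => (p@_(nth 0%MM (msupp p) i))%:MP).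
exists (fun i => (fg i).1 * (fg i).2); split=> [i|].
  by have [? ? _] := fgP i; exists (fg i).1, (fg i).2.
rewrite {1}[p]mpolyE (big_nth 0%MM) big_mkord; apply: eq_bigr => i _.
by have [_ _ <-] := fgP i; rewrite mul_mpolyC.
Qed.

Lemma stanley_span_box u Z p :
  stanley_span 'X_[u] Z p <-> supported (in_box (u, Z)) p.
Proof.
split=> [[f [fZ ->]] | supp_p].
  apply: (supportedM (Q1 := eq u) _ fZ) => [m|m1 m2 <- m2Z].
    by rewrite msuppX inE => /eqP.
  apply/forallP => i /=; rewrite mnmDE leq_addr; case: ifPn => // iZ.
  by case: (m2 i =P 0%N) => [->|/eqP/m2Z]; rewrite ?addn0 // (negPf iZ).
have um m : m \in msupp p -> (u <= m)%MM.
  move=> /supp_p/forallP um; apply/mnm_lepP => i; move: (um i) => /=.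
  by case: ifP => // _ /eqP->.
exists (\sum_(m <- msupp p) p@_m *: 'X_[m - u]); split.
  move=> m' /msupp_sum_le/flatten_mapP[m]; rewrite filter_predT => mp.
  move=> /msuppZ_le; rewrite msuppX inE => /eqP-> i; rewrite mnmBE.
  by move: (supp_p m mp) => /forallP/(_ i) /=; case: ifP => // _ /eqP->; rewrite subnn.
rewrite {1}[p]mpolyE big_distrr /=; apply: eq_big_seq => m mp.
by rewrite -scalerAr -mpolyXD addmC submK // um.
Qed.

(** A polynomial is split according to the boxes that contain its monomials. *)
Lemma box_partition_stanley (M : S -> Prop) P
    (s : seq ('X_{1..n} * {set 'I_n})) :
    (forall p, M p <-> supported P p) -> box_partition P s ->
  @stanley_decomposition K n M (size s) (fun i => 'X_[(nth (0%MM, set0) s i).1])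
    (fun i => (nth (0%MM, set0) s i).2).
Proof.
move=> MP sP; pose b (i : 'I_(size s)) := nth (0%MM, set0) s i.
have spanE i q : stanley_span 'X_[(b i).1] (b i).2 q <-> supported (in_box (b i)) q.
  by rewrite stanley_span_box; case: (b i).
have boxP i m : in_box (b i) m -> P m.
  move=> bm; apply: contrapT => nP; have := sP m; rewrite asboolF //.
  by apply/eqP; rewrite -lt0n -has_count; apply/hasP; exists (b i); rewrite ?mem_nth.
have box_sum m : P m -> (\sum_(i < size s) in_box (b i) m = 1)%N.
  move=> Pm; have := sP m; rewrite asboolT //= => <-.
  rewrite -sum1_count (big_nth (0%MM, set0)) big_mkord [RHS]big_mkcond.
  by apply: eq_bigr => i _; rewrite -/(b i); case: (in_box _ _).
have box_uniq m i j : in_box (b i) m -> in_box (b j) m -> i = j.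
  move=> bi bj; apply/eqP; apply: contraT => nij.
  have := box_sum _ (boxP _ _ bi); rewrite (bigD1 i) //= bi (bigD1 j) 1?eq_sym //= bj.
  by rewrite addnA.
split=> [i|p|q qspan sum0 i].
- split.
  + apply/MP => m; rewrite msuppX inE => /eqP->; apply: (boxP i).
    by apply/forallP => j; rewrite leqnn eqxx; case: ifP.
  + by exists 1, (b i).1; rewrite scale1r.
  + move=> f _ /eqP; rewrite mulf_eq0 => /orP[|/eqP//].
    by rewrite -msupp_eq0 msuppX.
- split=> [/MP supp_p | [q [qspan ->]]]; last first.
    apply/MP => m /msupp_sum_le/flatten_mapP[i _] mq.
    by apply: (boxP i); apply: (proj1 (spanE i (q i)) (qspan i)) mq.
  exists (fun i => \sum_(m <- msupp p | in_box (b i) m) p@_m *: 'X_[m]); split.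
    move=> i; apply/spanE => m /msupp_sum_le/flatten_mapP[m'].
    rewrite mem_filter => /andP[bm' _] /msuppZ_le.
    by rewrite msuppX inE => /eqP->.
  under eq_bigr do rewrite big_mkcond.
  rewrite exchange_big /= {1}[p]mpolyE; apply: eq_big_seq => m mp.
  rewrite -big_mkcond sumr_const /=.
  have := box_sum m (supp_p m mp); rewrite -big_mkcond sum1_card => -> //.
- apply/mpolyP => m; rewrite mcoeff0; apply/eqP; apply: contraT => qm.
  have bm : in_box (b i) m.
    by apply: (proj1 (spanE i (q i)) (qspan i)); rewrite mcoeff_msupp.
  have := congr1 (mcoeff m) sum0.
  rewrite raddf_sum /= mcoeff0 (bigD1 i) //= big1 ?addr0 => [/eqP|j nji].
    by rewrite (negPf qm).
  apply: memN_msupp_eq0; apply: contra nji => mq; apply/eqP.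
  by apply: (box_uniq m) bm; apply: (proj1 (spanE j (q j)) (qspan j)).
Qed.

Lemma sdepth_ge2 (M : S -> Prop) P : (1 < n)%N ->
  (forall p, M p <-> supported P p) -> depth_ge2 P -> le_enat (Fin 2) (sdepth M).
Proof.
move=> n_gt1 MP [s sZ sP]; rewrite /sdepth; case: asboolP => //= _.
pose Z (i : 'I_(size s)) := (nth (0%MM, set0) s i).2.
have leZn : (decomposition_sdepth Z < n.+1)%N.
  rewrite ltnS /decomposition_sdepth; elim/big_rec: _ => // i d _ le_dn.
  by rewrite geq_min le_dn orbT.
have geZ2 : (2 <= decomposition_sdepth Z)%N.
  rewrite /decomposition_sdepth; elim/big_rec: _ => // i d _ le_d.
  by rewrite leq_min le_d andbT (allP sZ) ?mem_nth.
apply: leq_trans geZ2 _.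
apply: (bigop.bigmax_sup (Ordinal leZn)) => //.
apply/asboolP; exists (size s), (fun i => 'X_[(nth (0%MM, set0) s i).1]), Z.
by split=> //; apply: box_partition_stanley.
Qed.

End Algebra.

Lemma girth_le n (G : sgraph n) c : has_cycle_of_length G c ->
  exists2 g, girth G = Fin g & (g <= c)%N.
Proof.
move=> Gc; rewrite /girth; case: pselect => [h|[]]; last by exists c.
by exists (ex_minn h) => //; case: ex_minnP => g _; apply.
Qed.

Theorem theorem3p4 (K : fieldType) (n : nat) (G : sgraph n)
    (Gconn : connected G) (Gbip : bipartite G)
    (Gedge : exists i j, edge G i j)
    (g : enat) (Ggirth : girth G = g)
    (k : nat) (k_gt0 : (0 < k)%N)
    (k_le : match g return Prop with
            | Fin m => (k%:R : rat) <= m%:R / 2%:R + 1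
            | Infty => True
            end) :
  le_enat (Fin 2) (sdepth (ideal_pow (@edge_ideal K n G) k)).
Proof.
have [B bipB] := Gbip; have [i [j ij]] := Gedge.
have n_gt1 : (1 < n)%N.
  rewrite -[n]card_ord (cardD1 i) (cardD1 j) !inE /=.
  suff -> : j != i by [].
  by apply: contraTneq ij => ->; rewrite edge_irrefl.
apply: (sdepth_ge2 n_gt1 (edge_ideal_powP G k)).
apply: (matchable_depth_ge2 bipB k_gt0) => c /girth_le[m gm le_mc].
move: k_le; rewrite -Ggirth gm => le_km.
have : (k.*2 <= m + 2)%N.
  rewrite -(ler_nat rat) natrD -muln2 natrM; lra.
by move/leq_trans; apply; rewrite leq_add2r.
Qed.
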